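(* Let $p$ be a prime, let $n$ and $m$ be positive integers, and let $f:\mathbb Q_p^n\to\mathbb Q_p^m$ be a $\mathrm{pReLU}$-network of input dimension $n$ and width $n$. Then either the restriction $f|_{\mathbb Z_p^n}$ is an affine map, or there is a ball $B\subset\mathbb Z_p^n$ of radius $\frac1p$ such that $f$ is constant in some direction on $B$, i.e. there is $h\in\mathbb Q_p^n$ with $\|h\|=\frac1p$ such that $f(x+h)=f(x)$ for every $x\in B$.
   Context: $\mathbb Q_p$ denotes the $p$-adic numbers, $\mathbb Z_p$ the $p$-adic integers, $|\cdot|$ the $p$-adic absolute value with $|p|=\frac1p$, and $\|(x_1,\dots,x_n)\|=\max_i|x_i|$ on $\mathbb Q_p^n$. A ball of radius $\rho$ is a set $B(v,\rho)=\{u\in\mathbb Q_p^n:\|u-v\|\le\rho\}$. The function $\mathrm{pReLU}:\mathbb Q_p\to\mathbb Q_p$ is defined by $\mathrm{pReLU}(x)=x$ if $x\in\mathbb Z_p$ and $0$ otherwise. A $\mathrm{pReLU}$-network with input dimension $d_x$, output dimension $d_y$ and hidden layer dimensions $d_1,\dots,d_{L-1}$ is a composition $t_L\circ\Sigma_{L-1}\circ t_{L-1}\circ\cdots\circ t_2\circ\Sigma_1\circ t_1:\mathbb Q_p^{d_x}\to\mathbb Q_p^{d_y}$, where (with $d_0=d_x$, $d_L=d_y$) each $t_l:\mathbb Q_p^{d_{l-1}}\to\mathbb Q_p^{d_l}$ is an affine map with coefficients in $\mathbb Q_p$ and $\Sigma_l$ applies $\mathrm{pReLU}$ to each coordinate.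 Its width is $\max(d_1,\dots,d_{L-1})$. *)

(* Defs.v *)
From HB Require Import structures.
From mathcomp Require Import all_boot all_order all_algebra.
From mathcomp Require Import generic_quotient ring_quotient.
From mathcomp Require Import boolp classical_sets functions.
From mathcomp Require Import ring lra.

Set Implicit Arguments.
Unset Strict Implicit.
Unset Printing Implicit Defensive.

Import Order.TTheory GRing.Theory Num.Theory.
Local Open Scope ring_scope.
Local Open Scope quotient_scope.

(* Q_p is not in the library: it is built below as the completion of [rat] for
   the p-adic absolute value, i.e. the ring of p-adically Cauchy sequences of
   rationals modulo the ideal of p-adically null sequences.  All absolute values
   are [rat]-valued, which loses nothing since |Q_p| = {0} U p^Z. *)

Section RatNorm.
Variables (p : nat) (p_prime : prime p).

Definition int_pnorm (a : int) : rat :=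
  if a == 0 then 0 else (p%:R ^+ logn p `|a|)^-1.

Definition rat_pnorm (x : rat) : rat := int_pnorm (numq x) / int_pnorm (denq x).

Let p_gt0 : 0 < p%:R :> rat.
Proof. by rewrite ltr0n prime_gt0. Qed.

Lemma int_pnorm0 : int_pnorm 0 = 0.
Proof. by []. Qed.

Lemma int_pnorm_gt0 a : a != 0 -> 0 < int_pnorm a.
Proof. by move=> a0; rewrite /int_pnorm (negPf a0) invr_gt0 exprn_gt0. Qed.

Lemma int_pnorm_ge0 a : 0 <= int_pnorm a.
Proof. by have [->//|a0] := eqVneq a 0; exact/ltW/int_pnorm_gt0. Qed.

Lemma int_pnormM (a b : int) : int_pnorm (a * b) = int_pnorm a * int_pnorm b.
Proof.
rewrite /int_pnorm mulf_eq0.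
have [->|a0] := eqVneq a 0; first by rewrite /= mul0r.
have [->|b0] := eqVneq b 0; first by rewrite orbT mulr0.
by rewrite /= abszM lognM ?absz_gt0 // exprD invfM.
Qed.

Lemma int_pnormN (a : int) : int_pnorm (- a) = int_pnorm a.
Proof. by rewrite /int_pnorm oppr_eq0 abszN. Qed.

Lemma int_pnormD (a b : int) : int_pnorm (a + b) <= Num.max (int_pnorm a) (int_pnorm b).
Proof.
have [->|a0] := eqVneq a 0; first by rewrite add0r le_max lexx orbT.
have [->|b0] := eqVneq b 0; first by rewrite addr0 le_max lexx.
have [->|ab0] := eqVneq (a + b) 0.
  by rewrite int_pnorm0 le_max int_pnorm_ge0.
have mono (i j : nat) : (i <= j)%N -> (p%:R ^+ j)^-1 <= (p%:R ^+ i)^-1 :> rat.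
  move=> ij; rewrite lef_pV2 ?posrE ?exprn_gt0 //.
  by rewrite ler_weXn2l // ler1n prime_gt0.
rewrite /int_pnorm (negPf a0) (negPf b0) (negPf ab0) le_max.
set i := logn p `|a|; set j := logn p `|b|.
have key k : (k <= i)%N -> (k <= j)%N -> (k <= logn p `|(a + b)%R|)%N.
  move=> ki kj; rewrite -pfactor_dvdn ?absz_gt0 //.
  have : ((p ^ k)%N%:Z %| (a + b)%R)%Z.
    by apply: rpredD; rewrite dvdzE /= pfactor_dvdn ?absz_gt0.
  by rewrite dvdzE.
have [ij|ji] := leqP i j; first by rewrite mono //; apply: key.
by rewrite orbC mono //; apply: key => //; apply: ltnW.
Qed.

Lemma rat_pnorm_frac (a b : int) : b != 0 ->
  rat_pnorm (a%:~R / b%:~R) = int_pnorm a / int_pnorm b.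
Proof.
move=> b0; set x := a%:~R / b%:~R.
have d0 : int_pnorm (denq x) != 0 by rewrite gt_eqF ?int_pnorm_gt0 ?denq_neq0.
have b0' : int_pnorm b != 0 by rewrite gt_eqF ?int_pnorm_gt0.
apply/eqP; rewrite /rat_pnorm eqr_div // -!int_pnormM; apply/eqP; congr int_pnorm.
apply: (@intr_inj rat); rewrite !intrM; apply/eqP.
rewrite -eqr_div ?intr_eq0 ?denq_neq0 //; apply/eqP; exact: divq_num_den.
Qed.

Lemma rat_pnorm0 : rat_pnorm 0 = 0.
Proof. by rewrite /rat_pnorm (_ : numq 0 = 0) // int_pnorm0 mul0r. Qed.

Lemma rat_pnorm1 : rat_pnorm 1 = 1.
Proof. by rewrite /rat_pnorm /int_pnorm /= logn1 expr0 invr1 divr1. Qed.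

Lemma rat_pnorm_ge0 x : 0 <= rat_pnorm x.
Proof. by rewrite divr_ge0 ?int_pnorm_ge0. Qed.

Lemma rat_pnorm_eq0 x : (rat_pnorm x == 0) = (x == 0).
Proof.
apply/eqP/eqP => [|->]; last exact: rat_pnorm0.
have [//|x0] := eqVneq x 0; move/eqP.
by rewrite gt_eqF // divr_gt0 // int_pnorm_gt0 ?denq_neq0 ?numq_eq0.
Qed.

Lemma rat_pnormM x y : rat_pnorm (x * y) = rat_pnorm x * rat_pnorm y.
Proof.
rewrite -{1}(divq_num_den x) -{1}(divq_num_den y) mulf_div -!intrM.
by rewrite rat_pnorm_frac ?mulf_neq0 ?denq_neq0 // !int_pnormM -mulf_div.
Qed.

Lemma rat_pnormN x : rat_pnorm (- x) = rat_pnorm x.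
Proof. by rewrite /rat_pnorm numqN denqN int_pnormN. Qed.

Lemma rat_pnormV x : rat_pnorm x^-1 = (rat_pnorm x)^-1.
Proof.
have [->|x0] := eqVneq x 0; first by rewrite invr0 rat_pnorm0 invr0.
have n0 : rat_pnorm x != 0 by rewrite rat_pnorm_eq0.
by apply: (mulfI n0); rewrite -rat_pnormM !divff ?rat_pnorm1.
Qed.

Lemma rat_pnormD x y : rat_pnorm (x + y) <= Num.max (rat_pnorm x) (rat_pnorm y).
Proof.
have dx := denq_neq0 x; have dy := denq_neq0 y.
rewrite -{1}(divq_num_den x) -{1}(divq_num_den y) addf_div ?intr_eq0 //.
rewrite -!intrM -intrD rat_pnorm_frac ?mulf_neq0 //.
rewrite ler_pdivrMr ?int_pnorm_gt0 ?mulf_neq0 //.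
apply: le_trans (int_pnormD _ _) _; rewrite maxr_pMl ?int_pnorm_ge0 //.
have dx' := int_pnorm_gt0 dx; have dy' := int_pnorm_gt0 dy.
rewrite !int_pnormM /rat_pnorm mulrA divfK ?gt_eqF // (mulrC (int_pnorm (denq x))).
by rewrite mulrA divfK ?gt_eqF.
Qed.

Lemma rat_pnormB x y : rat_pnorm (x - y) <= Num.max (rat_pnorm x) (rat_pnorm y).
Proof. by rewrite -(rat_pnormN y) rat_pnormD. Qed.

Lemma rat_pnormBC x y : rat_pnorm (x - y) = rat_pnorm (y - x).
Proof. by rewrite -rat_pnormN opprB. Qed.

Lemma rat_pnorm_eq x y : rat_pnorm (x - y) < rat_pnorm x -> rat_pnorm y = rat_pnorm x.
Proof.
move=> xy; apply/le_anti/andP; split.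
  rewrite -[y in X in X <= _](subKr x).
  by apply: le_trans (rat_pnormB _ _) _; rewrite ge_max lexx ltW.
rewrite leNgt; apply/negP => yx.
have := rat_pnormD (x - y) y; rewrite subrK le_max leNgt xy /=.
by rewrite leNgt yx.
Qed.

Lemma rat_pnorm_prime : rat_pnorm p%:R = p%:R^-1.
Proof.
rewrite /rat_pnorm /int_pnorm (_ : p%:R = p%:Z%:~R) // numq_int denq_int /=.
rewrite gt_eqF ?ltz_nat ?prime_gt0 //= logn1 expr0 invr1 divr1.
by rewrite -[X in logn _ X](expn1 p) pfactorK.
Qed.

Lemma rat_pnorm_val x : x != 0 -> exists k : int, rat_pnorm x = p%:R ^ k.
Proof.
move=> x0; rewrite /rat_pnorm /int_pnorm numq_eq0 (negPf x0).
rewrite (negPf (denq_neq0 x)) invrK.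
exists ((logn p `|denq x|)%:Z - (logn p `|numq x|)%:Z).
by rewrite expfzDr ?gt_eqF // -exprnN mulrC.
Qed.

End RatNorm.

Section Completion.
Variables (p : nat) (p_prime : prime p).
Local Notation "`| x |_p" := (rat_pnorm p x) (format "`| x |_p").

(* The (otherwise unused) primality argument allows the algebraic instances to
   be inferred from the type [Qp p_prime] alone. *)
Definition pcauchy of prime p : {pred nat -> rat} := fun u =>
  `[< forall e : rat, 0 < e -> exists N, forall i j, (N <= i)%N -> (N <= j)%N ->
        `|u i - u j|_p < e >].

Definition pnorm_cvg (u : nat -> rat) (l : rat) : Prop :=
  forall e : rat, 0 < e -> exists N, forall i, (N <= i)%N -> `| `|u i|_p - l | < e.

Lemma pnorm_cvg0 u : pnorm_cvg u 0 <->
  forall e : rat, 0 < e -> exists N, forall i, (N <= i)%N -> `|u i|_p < e.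
Proof.
by split=> h e /h[N Nh]; exists N => i /Nh; rewrite subr0 ger0_norm ?rat_pnorm_ge0.
Qed.

Lemma pcauchyP u : reflect (forall e : rat, 0 < e -> exists N, forall i j,
  (N <= i)%N -> (N <= j)%N -> `|u i - u j|_p < e) (u \in pcauchy p_prime).
Proof. exact: asboolP. Qed.

Lemma pcauchy_bounded u : u \in pcauchy p_prime ->
  exists2 M : rat, 0 < M & forall i, `|u i|_p <= M.
Proof.
move=> /pcauchyP/(_ 1 ltr01)[N Nu].
have [M M0 Mu] : exists2 M : rat, 0 < M & forall i, (i <= N)%N -> `|u i|_p <= M.
  elim: {Nu}N => [|N [M M0 Mu]].
    exists (1 + `|u 0%N|_p); first by rewrite ltr_wpDr ?rat_pnorm_ge0.
    by move=> i; rewrite leqn0 => /eqP ->; rewrite lerDr.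
  exists (M + `|u N.+1|_p); first by rewrite ltr_wpDr ?rat_pnorm_ge0.
  move=> i; rewrite leq_eqVlt => /predU1P[->|/Mu iM]; first by rewrite lerDr ltW.
  by apply: le_trans iM _; rewrite lerDl rat_pnorm_ge0.
exists (M + 1) => [|i]; first by rewrite addr_gt0.
have [iN|/ltnW Ni] := leqP i N; first by rewrite (le_trans (Mu _ iN)) // lerDl.
rewrite -(subrK (u N) (u i)) (le_trans (rat_pnormD p_prime _ _)) //.
rewrite ge_max (le_trans (ltW (Nu _ _ Ni (leqnn N)))) ?lerDr ?(ltW M0) //.
by rewrite (le_trans (Mu _ (leqnn N))) // lerDl.
Qed.

Lemma pcauchy_subring : subring_closed (pcauchy p_prime).
Proof.
split=> [|u v /pcauchyP hu /pcauchyP hv|u v hu hv]; apply/pcauchyP => e e0.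
- by exists 0%N => i j _ _; rewrite subrr rat_pnorm0.
- have [[M Mu] [N Nv]] := (hu e e0, hv e e0); exists (maxn M N) => i j.
  rewrite !geq_max => /andP[Mi Ni] /andP[Mj Nj].
  rewrite (_ : _ - _ = (u i - u j) - (v i - v j)); last first.
    by rewrite !fctE; ring.
  by rewrite (le_lt_trans (rat_pnormB p_prime _ _)) // gt_max Mu ?Nv.
have [[A A0 Au] [B B0 Bv]] := (pcauchy_bounded hu, pcauchy_bounded hv).
move/pcauchyP: hu => /(_ (e / B)); rewrite divr_gt0 // => -[//|M Mu].
move/pcauchyP: hv => /(_ (e / A)); rewrite divr_gt0 // => -[//|N Nv].
exists (maxn M N) => i j; rewrite !geq_max => /andP[Mi Ni] /andP[Mj Nj].
rewrite (_ : _ - _ = u i * (v i - v j) + (u i - u j) * v j); last first.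
  by rewrite !fctE; ring.
rewrite (le_lt_trans (rat_pnormD p_prime _ _)) // gt_max !rat_pnormM //.
apply/andP; split.
  apply: (@le_lt_trans _ _ (A * `|v i - v j|_p)); last by rewrite mulrC -ltr_pdivlMr ?Nv.
  by rewrite ler_wpM2r ?rat_pnorm_ge0.
apply: (@le_lt_trans _ _ (`|u i - u j|_p * B)); last by rewrite -ltr_pdivlMr ?Mu.
by rewrite ler_wpM2l ?rat_pnorm_ge0.
Qed.
HB.instance Definition _ :=
  GRing.isSubringClosed.Build _ (pcauchy p_prime) pcauchy_subring.

Definition pcauchy_seq := {u : nat -> rat | u \in pcauchy p_prime}.
HB.instance Definition _ := [Choice of pcauchy_seq by <:].
HB.instance Definition _ := SubType.on pcauchy_seq.
HB.instance Definition _ := [SubChoice_isSubComNzRing of pcauchy_seq by <:].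

Definition pnull_ideal : {pred pcauchy_seq} := fun u => `[< pnorm_cvg (val u) 0 >].

Lemma pnull_idealP u : reflect (forall e : rat, 0 < e ->
  exists N, forall i, (N <= i)%N -> `|val u i|_p < e) (u \in pnull_ideal).
Proof. by apply: (iffP (asboolP _)) => /pnorm_cvg0. Qed.

Lemma pnull_ideal_closed : idealr_closed pnull_ideal.
Proof.
split=> [||a u v /pnull_idealP hu /pnull_idealP hv].
- by apply/pnull_idealP => e e0; exists 0%N => i _; rewrite rat_pnorm0.
- apply/pnull_idealP => /(_ 1 ltr01)[N /(_ N (leqnn N))].
  by rewrite rat_pnorm1 ltxx.
have [A A0 Au] := pcauchy_bounded (valP a).
apply/pnull_idealP => e e0.
have [M Mu] := hu (e / A) (divr_gt0 e0 A0); have [N Nv] := hv e e0.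
exists (maxn M N) => i; rewrite geq_max => /andP[Mi Ni].
rewrite (le_lt_trans (rat_pnormD p_prime _ _)) // gt_max Nv // andbT rat_pnormM //.
apply: (@le_lt_trans _ _ (A * `|val u i|_p)); last by rewrite mulrC -ltr_pdivlMr ?Mu.
by rewrite ler_wpM2r ?rat_pnorm_ge0.
Qed.
HB.instance Definition _ := isIdealr.Build _ pnull_ideal pnull_ideal_closed.

Definition Qp := {ideal_quot pnull_ideal}.
HB.instance Definition _ := GRing.ComNzRing.on Qp.

Lemma Qp_eq (u v : pcauchy_seq) :
  (\pi_Qp u = \pi_Qp v) <-> u - v \in pnull_ideal.
Proof. by rewrite Quotient.idealrBE; split=> [->|/eqP]. Qed.

Lemma pi_Qp_eq0 (u : pcauchy_seq) : (\pi_Qp u = 0) <-> u \in pnull_ideal.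
Proof. by rewrite -(rmorph0 \pi_Qp) Qp_eq subr0. Qed.

Lemma pcauchy_nonnull (u : pcauchy_seq) : u \notin pnull_ideal ->
  exists2 c : rat, 0 < c & exists N, forall i, (N <= i)%N -> `|val u i|_p = c.
Proof.
move=> /pnull_idealP/existsNP[e /not_implyP[e0 /forallNP nu]].
have /pcauchyP/(_ e e0)[N Nu] := valP u.
have /existsNP[i /not_implyP[Ni /negP]] := nu N; rewrite -leNgt => ei.
exists `|val u i|_p; first exact: lt_le_trans e0 ei.
by exists N => j Nj; apply: rat_pnorm_eq => //; rewrite (lt_le_trans (Nu _ _ _ _)).
Qed.

Lemma Qp_mul_inv (x : Qp) : x != 0 -> exists y : Qp, y * x = 1.
Proof.
elim/quotW: x => u u0.
have [|c c0 [N Nu]] := @pcauchy_nonnull u.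
  by apply: contra_neqN u0 => /pi_Qp_eq0.
have wP : (fun i => (val u i)^-1) \in pcauchy p_prime.
  apply/pcauchyP => e e0; have /pcauchyP/(_ (e * (c * c))) := valP u.
  rewrite !mulr_gt0 // => -[//|M Mu]; exists (maxn M N) => i j.
  rewrite !geq_max => /andP[Mi Ni] /andP[Mj Nj].
  have nz k : (N <= k)%N -> val u k != 0.
    by move=> /Nu Nk; rewrite -(rat_pnorm_eq0 p_prime) Nk gt_eqF.
  have -> : (val u i)^-1 - (val u j)^-1 = (val u j - val u i) / (val u i * val u j).
    by field; rewrite !nz.
  rewrite rat_pnormM // rat_pnormV // rat_pnormM // !Nu //.
  by rewrite ltr_pdivrMr ?mulr_gt0 // Mu.
pose w : pcauchy_seq := Sub (fun i => (val u i)^-1) wP.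
exists (\pi_Qp w); rewrite -rmorphM -(rmorph1 (\pi_Qp)); apply/Qp_eq.
apply/pnull_idealP => e e0; exists N => i /Nu Ni.
rewrite (_ : val _ i = (val u i)^-1 * val u i - 1) // mulVf ?subrr ?rat_pnorm0 //.
by rewrite -(rat_pnorm_eq0 p_prime) Ni gt_eqF.
Qed.

Definition Qp_inv (x : Qp) : Qp :=
  if x == 0 then 0 else xget 0 [set y | y * x = 1]%classic.

Lemma Qp_mulVf (x : Qp) : x != 0 -> Qp_inv x * x = 1.
Proof.
move=> x0; rewrite /Qp_inv (negPf x0).
by have [y yx] := Qp_mul_inv x0; apply: (@xgetPex _ 0 [set y | y * x = 1]%classic); exists y.
Qed.

Lemma Qp_inv0 : Qp_inv 0 = 0.
Proof. by rewrite /Qp_inv eqxx. Qed.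

HB.instance Definition _ := GRing.ComNzRing_isField.Build Qp Qp_mulVf Qp_inv0.

(* |[(u_i)]| is the limit of |u_i|, which exists and does not depend on the
   representative, by [pnorm_pi] and [pnorm_cvg_ex]. *)
Definition pnorm (x : Qp) : rat :=
  xget 0 [set l | pnorm_cvg (val (repr x)) l]%classic.

Lemma pnorm_cvg_unique u l1 l2 : pnorm_cvg u l1 -> pnorm_cvg u l2 -> l1 = l2.
Proof.
move=> h1 h2; apply/eqP; rewrite -subr_eq0 -normr_le0 leNgt; apply/negP => d0.
have e0 : 0 < `|l1 - l2| / 2%:R by rewrite divr_gt0.
have [[M hM] [N hN]] := (h1 _ e0, h2 _ e0); set i := maxn M N.
have := ltrD (hM i (leq_maxl _ _)) (hN i (leq_maxr _ _)).
by have := ler_distD `|u i|_p l1 l2; rewrite (distrC l1 `|u i|_p); lra.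
Qed.

Lemma pnorm_cvg_ex (u : pcauchy_seq) : exists l, pnorm_cvg (val u) l.
Proof.
have [/pnull_idealP/pnorm_cvg0|/pcauchy_nonnull[c _ [N Nu]]] :=
  boolP (u \in pnull_ideal); first by exists 0.
by exists c => e e0; exists N => i /Nu ->; rewrite subrr normr0.
Qed.

Lemma pnorm_cvg_eq (u v : pcauchy_seq) l :
  \pi_Qp u = \pi_Qp v -> pnorm_cvg (val u) l -> pnorm_cvg (val v) l.
Proof.
move=> /Qp_eq uv ul.
have [un|/[dup] nun /pcauchy_nonnull[c c0 [N Nu]]] := boolP (u \in pnull_ideal).
  have vn : v \in pnull_ideal by rewrite -(subKr u v) rpredB.
  have /pnorm_cvg0/(pnorm_cvg_unique ul) -> := pnull_idealP _ un.
  exact/pnorm_cvg0/pnull_idealP.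
have uc : pnorm_cvg (val u) c.
  by move=> e e0; exists N => i /Nu ->; rewrite subrr normr0.
rewrite (pnorm_cvg_unique ul uc) => e e0.
have /pnull_idealP/(_ c c0)[M Muv] := uv.
exists (maxn M N) => i; rewrite geq_max => /andP[Mi Ni].
rewrite (@rat_pnorm_eq p p_prime (val u i)) ?Nu ?subrr ?normr0 //.
exact: Muv.
Qed.

Lemma pnorm_pi (u : pcauchy_seq) l : pnorm_cvg (val u) l -> pnorm (\pi_Qp u) = l.
Proof.
move=> ul; have rl : pnorm_cvg (val (repr (\pi_Qp u))) l.
  by apply: pnorm_cvg_eq ul; rewrite reprK.
apply: (pnorm_cvg_unique _ rl).
exact: (@xgetPex _ 0 [set l | pnorm_cvg (val (repr (\pi_Qp u))) l]%classic (ex_intro _ l rl)).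
Qed.

Lemma pnorm0 : pnorm 0 = 0.
Proof.
rewrite -(rmorph0 \pi_Qp); apply/pnorm_pi/pnorm_cvg0 => e e0.
by exists 0%N => i _; rewrite rat_pnorm0.
Qed.

Lemma pnorm_pi_eventually (u : pcauchy_seq) : \pi_Qp u != 0 ->
  exists N, forall i, (N <= i)%N -> `|val u i|_p = pnorm (\pi_Qp u).
Proof.
move=> u0; have [|c c0 [N Nu]] := @pcauchy_nonnull u.
  by apply: contra_neqN u0 => /pi_Qp_eq0.
exists N => i Ni; rewrite Nu //; apply/esym/pnorm_pi => e e0.
by exists N => j /Nu ->; rewrite subrr normr0.
Qed.

Lemma pnorm_val (x : Qp) : x != 0 -> exists k : int, pnorm x = p%:R ^ k.
Proof.
rewrite -[x]reprK => u0; have [N Nu] := pnorm_pi_eventually u0.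
rewrite -(Nu N) //; apply: rat_pnorm_val => //.
apply: contra_neq u0 => uN0; apply/pi_Qp_eq0/pnull_idealP => e e0.
by exists N => i /Nu ->; rewrite -(Nu N) // uN0 rat_pnorm0.
Qed.

Lemma pnorm_gt0 (x : Qp) : x != 0 -> 0 < pnorm x.
Proof. by move=> /pnorm_val[k ->]; rewrite exprz_gt0 // ltr0n prime_gt0. Qed.

Lemma pnorm_ge0 (x : Qp) : 0 <= pnorm x.
Proof. by have [->|/pnorm_gt0/ltW//] := eqVneq x 0; rewrite pnorm0. Qed.

Lemma pnorm_eq0 (x : Qp) : (pnorm x == 0) = (x == 0).
Proof.
have [->|/pnorm_gt0 x0] := eqVneq x 0; first by rewrite pnorm0 eqxx.
by rewrite gt_eqF.
Qed.

Lemma pnormM (x y : Qp) : pnorm (x * y) = pnorm x * pnorm y.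
Proof.
have [->|] := eqVneq x 0; first by rewrite mul0r pnorm0 mul0r.
have [->|] := eqVneq y 0; first by rewrite mulr0 pnorm0 mulr0.
rewrite -[x]reprK -[y]reprK; set u := repr x; set v := repr y.
move=> /pnorm_pi_eventually[M Mv] /pnorm_pi_eventually[N Nu].
rewrite -[_ * _](rmorphM \pi_Qp); apply: pnorm_pi => e e0.
exists (maxn M N) => i; rewrite geq_max => /andP[Mi Ni].
by rewrite rat_pnormM // Mv // Nu // subrr normr0.
Qed.

Lemma pnormD (x y : Qp) : pnorm (x + y) <= Num.max (pnorm x) (pnorm y).
Proof.
have [->|] := eqVneq x 0; first by rewrite add0r le_max lexx orbT.
have [->|] := eqVneq y 0; first by rewrite addr0 le_max lexx.
have [->|] := eqVneq (x + y) 0; first by rewrite pnorm0 le_max pnorm_ge0.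
rewrite -[x]reprK -[y]reprK; set u := repr x; set v := repr y.
rewrite -[_ + _](rmorphD \pi_Qp).
move=> /pnorm_pi_eventually[L Luv] /pnorm_pi_eventually[M Mv].
move=> /pnorm_pi_eventually[N Nu]; set i := maxn L (maxn M N).
by rewrite -(Luv i) -1?(Mv i) -1?(Nu i) ?rat_pnormD // !leq_max leqnn ?orbT.
Qed.

Lemma pnorm_prime : pnorm p%:R = p%:R^-1.
Proof.
rewrite -(rmorph_nat \pi_Qp); apply: pnorm_pi => e e0; exists 0%N => i _.
have valE k : val (k%:R : pcauchy_seq) i = k%:R.
  by elim: k => [//|k IHk]; rewrite -!natr1 -IHk.
by rewrite valE rat_pnorm_prime // subrr normr0.
Qed.

End Completion.

Section Networks.
Variable p : nat.
Variable p_prime : prime p.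
Local Notation K := (Qp p_prime).

Definition pReLU (x : K) : K := if pnorm x <= 1 then x else 0.

Definition sup_norm n (x : 'cV[K]_n) : rat := \big[Num.max/0]_(i < n) pnorm (x i ord0).

Definition padic_ball n (v : 'cV[K]_n) (r : rat) : set 'cV[K]_n :=
  [set u | sup_norm (u - v) <= r]%classic.

Definition padic_int_cube n : set 'cV[K]_n :=
  [set x | forall i, pnorm (x i ord0) <= 1]%classic.

Definition affine_map n m (A : 'M[K]_(m, n)) (b : 'cV[K]_m) (x : 'cV[K]_n) : 'cV[K]_m :=
  A *m x + b.

(* [network m n] is the data (t_1, ..., t_L) of a network with output dimension
   [m] and input dimension [n], listed from the input side. *)
Inductive network (m : nat) : nat -> Type :=
| Output n (A : 'M[K]_(m, n)) (b : 'cV[K]_m) : network m n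
| Hidden n d (A : 'M[K]_(d, n)) (b : 'cV[K]_d) (N : network m d) : network m n.

Fixpoint eval_network m n (N : network m n) : 'cV[K]_n -> 'cV[K]_m :=
  match N with
  | Output _ A b => affine_map A b
  | Hidden _ _ A b N' => fun x => eval_network N' (map_mx pReLU (affine_map A b x))
  end.

Fixpoint hidden_dims m n (N : network m n) : seq nat :=
  match N with
  | Output _ _ _ => [::]
  | Hidden _ d _ _ N' => d :: hidden_dims N'
  end.

(* The width of a network without hidden layer is 0. *)
Definition width m n (N : network m n) : nat := \max_(d <- hidden_dims N) d.

Definition is_pReLU_network n m (w : nat) (f : 'cV[K]_n -> 'cV[K]_m) : Prop :=
  exists2 N : network m n, width N = w & forall x, f x = eval_network N x.

Definition affine_on n m (D : set 'cV[K]_n) (f : 'cV[K]_n -> 'cV[K]_m) : Prop :=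
  exists A b, forall x, D x -> f x = affine_map A b x.

End Networks.

Arguments padic_int_cube {p} p_prime n _.

(* Main.v *)
(** As long as every affine coordinate feeding a hidden layer maps the unit cube
into the p-adic integers, pReLU acts as the identity and the layers compose to an
affine map.  At the first layer where some coordinate leaves the integers, that
coordinate has norm > 1 throughout some ball of radius 1/p, hence is sent to 0
there; the at most n - 1 other linear forms have a common zero h, scaled to norm
1/p, and translation by h does not change the output of the layer. *)

Require Import Defs.
From mathcomp Require Import all_boot all_order all_algebra.
From mathcomp Require Import classical_sets.

Import GRing.Theory Num.Theory.
Local Open Scope ring_scope.
Import Order.TTheory.
Local Open Scope classical_set_scope.

Section PadicNorm.
Set Implicit Arguments.
Unset Strict Implicit.
Variables (p : nat) (p_prime : prime p).
Local Notation K := (Qp p_prime).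

Lemma pnorm1 : pnorm (1 : K) = 1.
Proof.
have n1 : pnorm (1 : K) != 0 by rewrite pnorm_eq0 oner_neq0.
by apply: (mulfI n1); rewrite -pnormM !mulr1.
Qed.

Lemma pnormN (x : K) : pnorm (- x) = pnorm x.
Proof.
suff N1 : pnorm (-1 : K) = 1 by rewrite -mulN1r pnormM N1 mul1r.
apply/eqP; have : pnorm (-1 : K) ^+ 2 == 1.
  by rewrite expr2 -pnormM mulrNN mulr1 pnorm1.
rewrite sqrf_eq1 => /orP[//|/eqP N1].
by have := pnorm_ge0 (-1 : K); rewrite N1 oppr_ge0 ler10.
Qed.

Lemma pnormV (x : K) : pnorm x^-1 = (pnorm x)^-1.
Proof.
have [->|x0] := eqVneq x 0; first by rewrite invr0 pnorm0 invr0.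
have n0 : pnorm x != 0 by rewrite pnorm_eq0.
by apply: (mulfI n0); rewrite -pnormM !divff // pnorm1.
Qed.

Lemma pnormD_le (x y : K) r : pnorm x <= r -> pnorm y <= r -> pnorm (x + y) <= r.
Proof. by move=> xr yr; rewrite (le_trans (pnormD _ _)) // ge_max xr. Qed.

Lemma pnorm_sum_le (I : Type) (s : seq I) (P : pred I) (F : I -> K) r :
  0 <= r -> (forall i, P i -> pnorm (F i) <= r) ->
  pnorm (\sum_(i <- s | P i) F i) <= r.
Proof.
move=> r0 Fr; elim/big_ind: _ => //; first by rewrite pnorm0.
by move=> x y; apply: pnormD_le.
Qed.

(** Write [x = (x + y) - y]: in the ultrametric bound the maximum cannot be [pnorm y], which lies
    below [pnorm x]. *)
Lemma pnormD_dominant_ge (x y : K) : pnorm y < pnorm x -> pnorm x <= pnorm (x + y).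
Proof.
move=> yx; rewrite -{1}(addrK y x).
have := pnormD (x + y) (- y); rewrite pnormN addrK le_max => /orP[//|].
by rewrite leNgt yx.
Qed.

Lemma p_inv_lt1 : p%:R^-1 < 1 :> rat.
Proof. by rewrite invf_lt1 ?ltr0n ?ltr1n ?prime_gt0 ?prime_gt1. Qed.

Lemma p_inv_gt0 : 0 < p%:R^-1 :> rat.
Proof. by rewrite invr_gt0 ltr0n prime_gt0. Qed.

Lemma sup_norm_le n (x : 'cV[K]_n) r : 0 <= r ->
  (sup_norm x <= r) = [forall i, pnorm (x i ord0) <= r].
Proof.
move=> r0; apply/idP/forallP => [xr i|xr].
  by apply: le_trans xr; rewrite /sup_norm (bigD1 i) //= le_max lexx.
by rewrite /sup_norm; elim/big_ind: _ => // a b ar br; rewrite ge_max ar.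
Qed.

Lemma pnorm_le_sup_norm n (x : 'cV[K]_n) i : pnorm (x i ord0) <= sup_norm x.
Proof. by rewrite /sup_norm (bigD1 i) //= le_max lexx. Qed.

Lemma padic_ball_sub_cube n (v : 'cV[K]_n) :
  padic_int_cube p_prime n v ->
  padic_ball v p%:R^-1 `<=` padic_int_cube p_prime n.
Proof.
move=> v1 x xv i; rewrite -[x](subrK v) mxE pnormD_le //.
exact: le_trans (pnorm_le_sup_norm _ _) (le_trans xv (ltW p_inv_lt1)).
Qed.

(** A ball is a coset of the vectors of norm at most [r], which form a group by the ultrametric
    inequality. *)
Lemma padic_ballD n (v x h : 'cV[K]_n) r : 0 <= r -> sup_norm h <= r ->
  padic_ball v r x -> padic_ball v r (x + h).
Proof.
move=> r0 hr; rewrite /padic_ball /= addrAC => xr.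
move: hr xr; rewrite !sup_norm_le // => /forallP hr /forallP xr.
by apply/forallP => i; rewrite mxE pnormD_le.
Qed.

(** Fewer equations than unknowns leave a nonzero solution, which is then rescaled. As [kermx] is a
    left kernel, the solution is sought as a row vector for [A^T]. *)
Lemma kernel_sup_norm k n (A : 'M[K]_(k, n)) : (k < n)%N ->
  exists2 h : 'cV[K]_n, A *m h = 0 & sup_norm h = p%:R^-1.
Proof.
move=> kn; have : kermx A^T != 0.
  rewrite -mxrank_eq0 mxrank_ker -lt0n subn_gt0.
  exact: leq_ltn_trans (rank_leq_col _) kn.
case/rowV0Pn => u /sub_kermxP uA u0.
have [j uj0] : exists j, u ord0 j != 0.
  apply/existsP; apply: contraNT u0 => /existsPn u0.
  by apply/eqP/rowP => j; rewrite mxE; apply/eqP; rewrite -[_ == _]negbK.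
have [i _ imax] := @arg_maxP _ _ _ j xpredT (fun i => pnorm (u ord0 i)) isT.
have ui_gt0 : 0 < pnorm (u ord0 i).
  exact: lt_le_trans (pnorm_gt0 uj0) (imax j isT).
(* Dividing by the coordinate of largest norm gives sup norm 1; the factor [p] brings it to exactly
   1/p. *)
exists ((p%:R / u ord0 i) *: u^T).
  by rewrite -scalemxAr -[A]trmxK -trmx_mul uA trmx0 scaler0.
have hE k' : pnorm (((p%:R / u ord0 i) *: u^T) k' ord0)
             = p%:R^-1 * (pnorm (u ord0 k') / pnorm (u ord0 i)).
  by rewrite !mxE !pnormM pnormV pnorm_prime -!mulrA (mulrC (_^-1) (pnorm _)).
apply/le_anti/andP; split.
  rewrite sup_norm_le ?ltW ?p_inv_gt0 //; apply/forallP => k'.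
  rewrite hE ger_pMr ?p_inv_gt0 // ler_pdivrMr // mul1r.
  exact: imax.
by apply: le_trans (pnorm_le_sup_norm _ i); rewrite hE divff ?mulr1 // gt_eqF.
Qed.

Lemma affine_mapE n d (A : 'M[K]_(d, n)) b (x : 'cV[K]_n) i :
  affine_map A b x i ord0 = \sum_j A i j * x j ord0 + b i ord0.
Proof. by rewrite !mxE. Qed.

(* The centre is chosen among 0 and the basis vectors: with [M] the largest norm
   of the coordinate there, all coefficients have norm at most [M], so the
   coordinate moves by at most [M / p] on a ball of radius 1/p. *)
Lemma affine_coordinate_large_on_ball n d (A : 'M[K]_(d, n)) b i :
  (exists2 x, padic_int_cube p_prime n x & 1 < pnorm (affine_map A b x i ord0)) ->
  exists2 v, padic_int_cube p_prime n v &
    forall x, padic_ball v p%:R^-1 x -> 1 < pnorm (affine_map A b x i ord0).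
Proof.
case=> x0 x0_cube x0_large.
pose l x := affine_map A b x i ord0.
(* [None] encodes the origin, where [l] takes the value [b i ord0]. *)
pose e (o : option 'I_n) : 'cV[K]_n := if o is Some j then delta_mx j ord0 else 0.
have e_cube o : padic_int_cube p_prime n (e o).
  case: o => [j|] k /=; rewrite mxE ?pnorm0 //.
  by rewrite eqxx andbT; case: (k == j); rewrite ?pnorm1 ?pnorm0.
have [o _ omax] :=
  @arg_maxP _ _ _ (None : option 'I_n) xpredT (fun o => pnorm (l (e o))) isT.
set M := pnorm (l (e o)) in omax.
have b_le : pnorm (b i ord0) <= M.
  have := omax None isT; rewrite /l affine_mapE big1 ?add0r // => j _.
  by rewrite mxE mulr0.
(* Each coefficient is the difference of the values of [l] at a basis vector and at the origin. *)
have a_le j : pnorm (A i j) <= M.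
  have -> : A i j = l (e (Some j)) - b i ord0.
    rewrite /l affine_mapE addrK (bigD1 j) //= big1 ?addr0 => [|k /negPf kj].
      by rewrite mxE !eqxx mulr1.
    by rewrite mxE kj mulr0.
  by apply: pnormD_le; rewrite ?pnormN //; apply: omax.
have M0 : 0 <= M by apply: pnorm_ge0.
(* On the cube every term of the affine form has norm at most [M], so the large value at [x0] forces
   [M] above 1. *)
have M_gt1 : 1 < M.
  apply: lt_le_trans x0_large _; rewrite affine_mapE pnormD_le //.
  apply: pnorm_sum_le => // j _; rewrite pnormM.
  by apply: le_trans (a_le j); rewrite ler_piMr ?pnorm_ge0 ?x0_cube.
exists (e o) => // x xv.
have lxE : affine_map A b x i ord0
           = l (e o) + \sum_j A i j * (x - e o) j ord0.
  rewrite /l !affine_mapE addrAC -big_split /=; congr (_ + _).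
  by apply: eq_bigr => j _; rewrite -mulrDr !mxE addrCA subrr addr0.
rewrite (lt_le_trans M_gt1) // lxE; apply: pnormD_dominant_ge.
apply: (@le_lt_trans _ _ (M / p%:R)); last first.
  by rewrite gtr_pMr ?p_inv_lt1 ?(lt_trans ltr01 M_gt1).
apply: pnorm_sum_le => [|j _]; first by rewrite mulr_ge0 // ltW ?p_inv_gt0.
rewrite pnormM ler_pM ?pnorm_ge0 //.
exact: le_trans (pnorm_le_sup_norm _ _) xv.
Qed.

(** The codomain is an arbitrary type, so that the property can be stated for one layer and carried
    through whatever follows it. *)
Definition constant_direction {n : nat} {T : Type} (f : 'cV[K]_n -> T) : Prop :=
  exists v : 'cV[K]_n,
    padic_ball v (p%:R^-1) `<=` padic_int_cube p_prime n /\
    exists h : 'cV[K]_n, sup_norm h = p%:R^-1 /\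
      forall x, padic_ball v (p%:R^-1) x -> f (x + h) = f x.

Lemma pReLU_layer_dichotomy n d (A : 'M[K]_(d, n)) b : (0 < n)%N -> (d <= n)%N ->
  {in padic_int_cube p_prime n,
    forall x, map_mx (@pReLU _ p_prime) (affine_map A b x) = affine_map A b x} \/
  constant_direction (fun x => map_mx (@pReLU _ p_prime) (affine_map A b x)).
Proof.
move=> n0 dn.
have [[i bad]|good] := boolp.pselect (exists i, exists2 x,
  padic_int_cube p_prime n x & 1 < pnorm (affine_map A b x i ord0)); last first.
  left=> x; rewrite inE => x_cube; apply/colP => i; rewrite mxE /pReLU.
  by case: leP => // large; case: good; exists i, x.
right; have [v v_cube large] := @affine_coordinate_large_on_ball n d A b i bad.
(* Without row [i] there remain [d - 1] rows, fewer than [n], since [i] itself shows that [d] is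
   positive. *)
have [|h Ah h_norm] := @kernel_sup_norm d.-1 n (row' i A).
  by rewrite prednK // (leq_ltn_trans _ (ltn_ord i)).
exists v; split; first exact: padic_ball_sub_cube.
exists h; split=> // x xv.
have xhv : padic_ball v p%:R^-1 (x + h).
  by apply: padic_ballD => //; rewrite ?h_norm ?(ltW p_inv_gt0).
apply/colP => k; rewrite [LHS]mxE [RHS]mxE /pReLU.
(* Coordinate [i] is sent to 0 at both [x] and [x + h]; the others agree already before pReLU. *)
have [ki|] := eqVneq i k.
  by rewrite -ki !leNgt !large.
case/unlift_some => k' kE _; suff -> : affine_map A b (x + h) k ord0
                                      = affine_map A b x k ord0 by [].
have Ahk : \sum_j row' i A k' j * h j ord0 = 0.
  by move/colP/(_ k'): Ah; rewrite !mxE.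
rewrite !affine_mapE; congr (_ + _); rewrite -[RHS]addr0 -[X in _ = _ + X]Ahk -big_split /=.
by apply: eq_bigr => j _; rewrite !mxE mulrDr kE.
Qed.

Lemma constant_direction_comp n (T U : Type) (g : 'cV[K]_n -> T) (f : T -> U) :
  constant_direction g -> constant_direction (f \o g).
Proof.
case=> v [v_cube [h [h_norm gh]]]; exists v; split=> //; exists h; split=> //.
by move=> x /gh /= ->.
Qed.

(** Induction on the network. The leading affine map absorbs each layer on which pReLU acts as the
    identity, so the input dimension stays [n] while the network shrinks. *)
Lemma eval_network_dichotomy n m d (N : network p_prime m d)
    (A : 'M[K]_(d, n)) b : (0 < n)%N -> (width N <= n)%N ->
  affine_on (padic_int_cube p_prime n) (eval_network N \o affine_map A b) \/
  constant_direction (eval_network N \o affine_map A b).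
Proof.
move=> n0; elim: N A b => {d} [d A1 b1|d d' A1 b1 N IHN] A b; rewrite /width /=.
  move=> _; left; exists (A1 *m A), (A1 *m b + b1) => x _.
  by rewrite /affine_map /= mulmxDr mulmxA addrA.
rewrite big_cons geq_max => /andP[dn Nn].
have foldE x : affine_map A1 b1 (affine_map A b x)
               = affine_map (A1 *m A) (A1 *m b + b1) x.
  by rewrite /affine_map mulmxDr mulmxA addrA.
have -> : (fun x => eval_network N (map_mx (@pReLU p p_prime) (affine_map A1 b1 x)))
    \o affine_map A b = eval_network N \o (fun x =>
      map_mx (@pReLU p p_prime) (affine_map (A1 *m A) (A1 *m b + b1) x)).
  by apply: boolp.funext => x /=; rewrite foldE.
have [id_layer|] := pReLU_layer_dichotomy (A1 *m A) (A1 *m b + b1) n0 dn; last first.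
  by right; apply: constant_direction_comp.
have [[C [c affC]]|[v [v_cube [h [h_norm fh]]]]] := IHN (A1 *m A) (A1 *m b + b1) Nn.
  by left; exists C, c => x x_cube; rewrite -affC //= id_layer ?inE.
right; exists v; split=> //; exists h; split=> // x xv /=.
(* pReLU may be dropped only on the cube, so both [x] and [x + h] must be placed in the ball, which
   lies inside the cube. *)
rewrite !id_layer ?inE; [exact: fh|exact: v_cube|].
by apply/v_cube/padic_ballD; rewrite ?h_norm ?(ltW p_inv_gt0).
Qed.
End PadicNorm.

Theorem theorem2p13 (p : nat) (p_prime : prime p) (n m : nat)
    (n_gt0 : (0 < n)%N) (m_gt0 : (0 < m)%N)
    (f : 'cV[Qp p_prime]_n -> 'cV[Qp p_prime]_m)
    (f_network : is_pReLU_network n f) :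
  affine_on (padic_int_cube p_prime n) f \/
  exists v : 'cV[Qp p_prime]_n,
    padic_ball v (p%:R^-1) `<=` padic_int_cube p_prime n /\
    exists h : 'cV[Qp p_prime]_n, sup_norm h = p%:R^-1 /\
      forall x, padic_ball v (p%:R^-1) x -> f (x + h) = f x.
Proof.
case: f_network => N widthN fE.
(* The induction starts with the identity as the absorbed affine map. *)
have -> : f = eval_network N \o affine_map 1%:M 0.
  by apply: boolp.funext => x; rewrite fE /= /affine_map mul1mx addr0.
by apply: eval_network_dichotomy; rewrite ?widthN.
Qed.
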